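(* Suppose $\eta$ is a random particle configuration whose path encoding has distribution supported in $\mathcal{S}_{critical}$. (a) It holds that $T\eta\overset{d}{=}\eta$ if and only if $\eta\overset{d}{=}1-\eta$. Moreover, under either of these conditions, $T\eta=1-\eta$, $\mathbf{P}$-a.s. (b) If $T\eta\overset{d}{=}\eta$, then $\eta$ is ergodic under $T$ if and only if the distribution of $\eta$ is supported on a two point set of the form $\{\eta^*,1-\eta^*\}\subseteq\mathcal{S}_{critical}$.
   Context: $\mathbb{N}=\{1,2,\dots\}$. A particle configuration is $\eta=(\eta_n)_{n\in\mathbb{Z}}\in\{0,1\}^{\mathbb{Z}}$; a random one is defined on a probability space with probability measure $\mathbf{P}$. $1-\eta$ denotes $(1-\eta_n)_{n\in\mathbb{Z}}$. The path encoding of $\eta$ is $S=(S_n)_{n\in\mathbb{Z}}$ with $S_0=0$, $S_n-S_{n-1}=1-2\eta_n$. This identifies $\{0,1\}^{\mathbb{Z}}$ with $\mathcal{S}^0=\{S:\mathbb{Z}\to\mathbb{Z} : S_0=0,\ |S_n-S_{n-1}|=1\ \forall n\}$, and sets of paths are also regarded as sets of configurations. Let $M_n=\sup_{m\le n}S_m$, $I_n=\inf_{m\ge n}S_m$. When $M_0<\infty$, $(TS)_n=2M_n-S_n-2M_0$, and $T\eta$ is the configuration with path encoding $TS$. Let $\mathcal{S}_{critical}^{\pm}$ be the set of $S\in\mathcal{S}^0$ with $\sup_{n\in\mathbb{Z}}(M_n-I_n)=\limsup_{n\to\pm\infty}S_n-\liminf_{n\to\pm\infty}S_n=K$ for some $K\in\mathbb{N}$,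 and $\mathcal{S}_{critical}=\mathcal{S}_{critical}^-\cap\mathcal{S}_{critical}^+$ (on which $T$ is well-defined). ''Ergodic under $T$'' means that the $T$-invariant law of $\eta$ is ergodic for the map $T$. *)

(* Defs.v *)
From HB Require Import structures.
From mathcomp Require Import all_boot all_order all_algebra.
From mathcomp Require Import all_classical all_reals all_analysis.
From mathcomp Require Import measurable_realfun.
From mathcomp Require Import zify ring lra.

Set Implicit Arguments.
Unset Strict Implicit.
Unset Printing Implicit Defensive.

Import Order.TTheory GRing.Theory Num.Theory.
Import numFieldNormedType.Exports.

Local Open Scope classical_set_scope.
Local Open Scope ring_scope.

(* {0,1}^Z with the product sigma-algebra; true encodes a particle (1). *)
Definition cylinders : set (set (int -> bool)) :=
  [set A | exists n : int, A = [set eta : int -> bool | eta n]].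

Definition config := g_sigma_algebraType cylinders.

HB.instance Definition _ := Measurable.on config.

(* 1 - eta *)
Definition flip (eta : config) : config := fun n => ~~ eta n.

Section paths.
Variable R : realType.

(* Paths are given values in R, in which Z is embedded, so that suprema and
   upper limits can be taken in \bar R. *)
Implicit Types (S : int -> R) (eta : config) (n : int).

Definition step eta n : R := 1 - 2 * (eta n)%:R.

(* S_0 = 0 and S_n - S_(n-1) = 1 - 2 eta_n; see encoding0 and encodingB.
   Recall that Negz m is - (m + 1). *)
Definition encoding eta : int -> R := fun n =>
  match n with
  | Posz m => \sum_(1 <= k < m.+1) step eta k%:Z
  | Negz m => - \sum_(0 <= k < m.+1) step eta (- k%:Z)
  end.

(* The paths S^0; these conditions force S to be integer-valued. *)
Definition paths0 : set (int -> R) :=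
  [set S | S 0 = 0 /\ forall n, `|S n - S (n - 1)| = 1].

(* The inverse of encoding on paths0; see encodingK and decodingK. *)
Definition decoding S : config := fun n => S n - S (n - 1) == -1.

Definition runmax S n : \bar R :=
  ereal_sup [set (S m)%:E | m in [set m : int | m <= n]].

Definition runmin S n : \bar R :=
  ereal_inf [set (S m)%:E | m in [set m : int | n <= m]].

(* T on paths and on configurations. They are only meaningful when
   M_0 < +oo, in which case every M_n is finite; otherwise fine returns
   junk values. *)
Definition pitman_path S : int -> R := fun n =>
  2 * fine (runmax S n) - S n - 2 * fine (runmax S 0).

Definition pitman eta : config := decoding (pitman_path (encoding eta)).

(* sup_n (M_n - I_n) *)
Definition width S : \bar R := ereal_sup (range (fun n => runmax S n - runmin S n)%E).

(* limsup - liminf of a sequence; equal to -oo when both are infinite with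
   the same sign. *)
Definition oscillation (u : nat -> \bar R) : \bar R :=
  (limn_esup u - limn_einf u)%E.

Definition Scritical_plus : set (int -> R) :=
  [set S | paths0 S /\ exists K : nat, [/\ (0 < K)%N, width S = K%:R%:E &
     oscillation (fun k : nat => (S k%:Z)%:E) = K%:R%:E]].

Definition Scritical_minus : set (int -> R) :=
  [set S | paths0 S /\ exists K : nat, [/\ (0 < K)%N, width S = K%:R%:E &
     oscillation (fun k : nat => (S (- k%:Z))%:E) = K%:R%:E]].

Definition Scritical : set (int -> R) := Scritical_minus `&` Scritical_plus.

(* Scritical as a set of configurations *)
Definition critical : set config := encoding @^-1` Scritical.

End paths.

Section laws.
Context d (Om : measurableType d) (R : realType) (P : probability Om R).

(* Equality in distribution; both maps are meant to be measurable. *)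
Definition eq_law (X Y : Om -> config) : Prop :=
  forall A : set config, measurable A -> pushforward P X A = pushforward P Y A.

End laws.

(* Ergodicity of mu for a self-map f of D, where mu is supported in D and f
   is given as a total function whose values outside D are irrelevant:
   f-invariant events (as subsets of D) have measure 0 or 1. *)
Definition ergodic_on d (X : measurableType d) (R : realType)
    (D : set X) (f : X -> X) (mu : set X -> \bar R) : Prop :=
  forall A : set X, measurable A -> D `&` f @^-1` A = D `&` A ->
    mu A = 0%E \/ mu A = 1%E.

Section facts.
Variable R : realType.
Implicit Types (S : int -> R) (eta : config) (n : int).

Lemma encoding0 eta : encoding R eta 0 = 0.
Proof. by rewrite /encoding /= big_geq. Qed.

Lemma encodingB eta n :
  encoding R eta n - encoding R eta (n - 1) = 1 - 2 * (eta n)%:R.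
Proof.
case: n => [[|m]|m].
- rewrite encoding0 (_ : 0%:Z - 1 = Negz 0)//= big_nat1 opprK add0r.
  by rewrite /step oppr0.
- rewrite (_ : m.+1%:Z - 1 = m%:Z); last lia.
  by rewrite [X in X - _ = _]big_nat_recr//= addrAC subrr add0r.
- rewrite (_ : Negz m - 1 = Negz m.+1); last lia.
  rewrite /= opprK [X in _ + X = _]big_nat_recr//= addKr.
  by rewrite /step NegzE.
Qed.

Lemma encoding_paths0 eta : paths0 (encoding R eta).
Proof.
split=> [|n]; first exact: encoding0.
rewrite encodingB; case: (eta n); rewrite /= ?mulr1 ?mulr0 ?subr0 ?normr1//.
by rewrite (_ : 1 - 2 = -1 :> R) ?normrN1//; lra.
Qed.

Lemma encodingK eta : decoding (encoding R eta) = eta.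
Proof.
apply/funext => n; rewrite /decoding encodingB.
by case: (eta n) => /=; [apply/eqP|apply/negbTE/eqP]; lra.
Qed.

Lemma decodingK S : paths0 S -> encoding R (decoding S) = S.
Proof.
move=> [S0 S1].
have dB n : encoding R (decoding S) n - encoding R (decoding S) (n - 1) =
    S n - S (n - 1).
  rewrite encodingB /decoding; case: eqP => /= [->|neq]; first by lra.
  have /eqP := S1 n; rewrite eqr_norml ler01 andbT => /orP[/eqP->|/eqP//].
  by lra.
apply/funext; elim/int_ind => [|n IH|n IH].
- by rewrite encoding0 S0.
- have := dB n.+1%:Z; rewrite (_ : n.+1%:Z - 1 = n%:Z); last lia.
  by rewrite IH; lra.
- have := dB (- n%:Z); rewrite (_ : - n%:Z - 1 = - n.+1%:Z); last lia.
  by rewrite IH; lra.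
Qed.

Lemma encoding_int eta n : encoding R eta n \is a Num.int.
Proof.
have st k : step R eta k \is a Num.int.
  by rewrite /step rpredB ?rpred1// rpredM// natr_int.
by case: n => m /=; rewrite ?rpredN; apply: rpred_sum => k _.
Qed.

Lemma runmax_ge S m n : m <= n -> ((S m)%:E <= runmax S n)%E.
Proof. by move=> mn; apply: ereal_sup_ubound; exists m. Qed.

Lemma runmaxB S n : runmax S n = maxe (runmax S (n - 1)) (S n)%:E.
Proof.
apply/eqP; rewrite eq_le; apply/andP; split.
- apply: ge_ereal_sup => _ [m /= mn <-]; rewrite le_max.
  have [->|mn'] := eqVneq m n; first by rewrite lexx orbT.
  by rewrite runmax_ge//; move: mn mn'; lia.
- rewrite ge_max runmax_ge ?lexx// andbT.
  apply: ereal_sup_le; apply: image_subset => m /= mn.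
  by move: mn; lia.
Qed.

Lemma runmax_fin_num eta n : (runmax (encoding R eta) 0 < +oo)%E ->
  runmax (encoding R eta) n \is a fin_num.
Proof.
move=> M0; rewrite fin_numE; apply/andP; split.
  by rewrite -ltNye (lt_le_trans _ (runmax_ge _ (lexx n)))// ltNyr.
rewrite -ltey; elim/int_ind: n => [//|n IH|n IH].
- rewrite runmaxB (_ : n.+1%:Z - 1 = n%:Z); last lia.
  by rewrite gt_max IH ltry.
- have := IH; rewrite runmaxB (_ : - n%:Z - 1 = - n.+1%:Z); last lia.
  by rewrite gt_max => /andP[].
Qed.

(* A running maximum is attained. *)
Lemma runmax_int eta n : (runmax (encoding R eta) 0 < +oo)%E ->
  exists2 m, m <= n & runmax (encoding R eta) n = (encoding R eta m)%:E.
Proof.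
move=> /(runmax_fin_num n) fM; set M := runmax _ n.
have : (M - 1%:E < M)%E by rewrite lteBlDr// lteDl// lte01.
move=> /ereal_sup_gt[_ [m mn <-] ltm]; exists m => //.
apply/eqP; rewrite eq_le runmax_ge// andbT.
apply: ge_ereal_sup => _ [k kn <-]; rewrite lee_fin.
have : ((encoding R eta k)%:E < (encoding R eta m + 1)%:E)%E.
  apply: le_lt_trans (runmax_ge _ kn) _.
  by move: ltm; rewrite lteBlDr.
rewrite lte_fin.
have /intrP[a ->] := encoding_int eta k; have /intrP[b ->] := encoding_int eta m.
by rewrite -intrD1 ltr_int ler_int; lia.
Qed.

(* pitman eta is the configuration with path encoding T S. *)
Lemma encoding_pitman eta : (runmax (encoding R eta) 0 < +oo)%E ->
  encoding R (pitman R eta) = pitman_path (encoding R eta).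
Proof.
move=> M0; apply: decodingK; split=> [|n].
  by rewrite /pitman_path encoding0; ring.
rewrite /pitman_path; set S := encoding R eta in M0 *.
have [m mn Mm] := runmax_int (n - 1) M0; rewrite -/S in Mm.
have := runmaxB S n; rewrite Mm => ->.
have Sm1 : S (n - 1) <= S m.
  by rewrite -lee_fin -Mm runmax_ge.
rewrite -EFin_max /=.
have := encoding_int eta m; have := encoding_int eta (n - 1).
have := encoding_int eta n; rewrite -/S.
have [_ /(_ n)] := encoding_paths0 eta; rewrite -/S.
move=> SB /intrP[a Sa] /intrP[b Sb] /intrP[c Sc].
move: SB Sm1; rewrite Sa Sb Sc -intrB -intr_norm ler_int => /eqP.
rewrite -[X in _ == X]/(1%:~R) eqr_int => /eqP ab bc.
set t := fine _.
rewrite (_ : Num.max c%:~R a%:~R = (Num.max c a)%:~R :> R); last first.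
  by rewrite !maxEle ler_int; case: (c <= a).
rewrite [X in `|X| = _](_ : _ = (2 * (Num.max c a - c) - (a - b))%:~R); last first.
  by rewrite !(rmorphB, rmorphM)/=; ring.
by rewrite -intr_norm [X in X%:~R](_ : _ = 1)//; lia.
Qed.

End facts.

Section measurability.
Variable R : realType.

Lemma measurable_config_bool d (X : measurableType d) (f : X -> config) :
  (forall n, measurable [set x | f x n]) -> measurable_fun setT f.
Proof.
move=> mf; apply: (@measurability _ _ X config setT f cylinders) => //.
by move=> _ [_ [n ->] <-]; rewrite setTI; exact: mf.
Qed.

Lemma measurable_coord (n : int) : measurable [set eta : config | eta n].
Proof. by apply: sub_sigma_algebra; exists n. Qed.

Lemma measurable_flip : measurable_fun setT flip.
Proof.
apply: measurable_config_bool => n.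
rewrite (_ : [set _ | _] = ~` [set eta : config | eta n]).
  by apply: measurableC; exact: measurable_coord.
by apply/seteqP; split=> eta /= /negP.
Qed.

Lemma measurable_encoding (n : int) :
  measurable_fun setT (fun eta : config => encoding R eta n).
Proof.
have st k : measurable_fun setT (fun eta : config => step R eta k).
  rewrite (_ : (fun _ => _) = fun eta : config =>
      1 - 2 * \1_[set eta : config | eta k] eta); last first.
    apply/funext => eta; rewrite /step indicE; congr (_ - _ * _%:R).
    by congr nat_of_bool; apply/idP/idP; rewrite inE.
  apply: measurable_funB => //; apply: measurable_funM => //.
  by apply: measurable_indic; exact: measurable_coord.
case: n => m /=; first exact: measurable_sum.
by apply: measurableT_comp => //; exact: measurable_sum.
Qed.

Lemma measurable_runmax (n : int) :
  measurable_fun setT (fun eta : config => runmax (encoding R eta) n).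
Proof.
rewrite (_ : (fun _ => _) = fun eta : config =>
    ereal_sup (range (fun k : nat => (encoding R eta (n - k%:Z))%:E))).
  apply: (@eq_measurable_fun _ _ _ _ setT (fun eta : config =>
    esups (fun k : nat => (encoding R eta (n - k%:Z))%:E) 0)).
    move=> eta _; rewrite /esups /sdrop /=; congr ereal_sup.
    by apply/seteqP; split=> _ [k _ <-]; exists k.
  apply: measurable_fun_esups => k; apply/measurable_EFinP.
  exact: measurable_encoding.
apply/funext => eta; congr ereal_sup; apply/seteqP; split=> _ [m /= mn <-].
  by exists `|n - m|%N => //=; do 2 f_equal; lia.
by exists (n - m%:Z) => //=; lia.
Qed.

Lemma measurable_pitman : measurable_fun setT (pitman R).
Proof.
have mT n : measurable_fun setT
    (fun eta : config => pitman_path (encoding R eta) n).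
  by repeat apply: measurable_funB; (apply: measurable_funM => //;
     apply: measurableT_comp => //; exact: measurable_runmax)
     || exact: measurable_encoding.
apply: measurable_config_bool => n.
rewrite (_ : [set _ | _] = (fun eta => pitman_path (encoding R eta) n -
    pitman_path (encoding R eta) (n - 1)) @^-1` [set -1]).
  rewrite -[X in measurable X]setTI.
  by apply: measurable_funB.
by apply/seteqP; split=> eta /= /eqP.
Qed.

End measurability.

(* Main.v *)
(* Let b be the upper limit of S at -oo. If S never exceeds b, then every M_n
   is b and T eta = 1 - eta. Otherwise S has a first strict record time, and
   criticality makes the first record time of T eta strictly later than that
   of eta; this is incompatible with T eta and eta having the same law. On the
   other hand, if both eta and 1 - eta are critical, then S has no record.
   Hence each of the two invariances gives T eta = 1 - eta a.s., and so the
   other one. Under ergodicity the events {eta_0 <> eta_n}, being invariant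
   under eta |-> 1 - eta, are trivial, so that eta is determined by eta_0. *)
Require Import Defs.
From HB Require Import structures.
From mathcomp Require Import all_boot all_order all_algebra.
From mathcomp Require Import all_classical all_reals all_analysis.
From mathcomp Require Import measurable_realfun.
From mathcomp Require Import zify ring lra.

Set Implicit Arguments.
Unset Strict Implicit.
Unset Printing Implicit Defensive.

Import Order.TTheory GRing.Theory Num.Theory.
Import numFieldNormedType.Exports.

Local Open Scope classical_set_scope.
Local Open Scope ring_scope.

(** * Limits of a critical path at minus infinity *)

Section critical_paths.
Variable R : realType.
Implicit Types (S : int -> R) (x : config).

Lemma int_num_dist_lt1 (a b : R) :
  a \is a Num.int -> b \is a Num.int -> `|a - b| < 1 -> a = b.
Proof.
move=> /intrP[i ->] /intrP[j ->].
by rewrite -intrB -intr_norm ltrz1 => ij; congr (_%:~R); lia.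
Qed.

(** Late terms above [l - 1/2] lie within 1/2 of [l], so any two differ by less than 1 and
    integrality makes them one value [b]. Two bounds [|b - l| < 1/2] suffice in [critical_left] to
    identify integers. *)
Lemma limn_esup_int (u : nat -> R) (l : R) :
    (forall k, u k \is a Num.int) -> limn_esup (fun k => (u k)%:E) = l%:E ->
  exists b, [/\ b \is a Num.int, `|b - l| < 2^-1,
    forall n, exists2 k, (n <= k)%N & u k = b
    & exists n, forall k, (n <= k)%N -> u k <= b].
Proof.
move=> ui ul.
have often n : exists2 k, (n <= k)%N & l - 2^-1 < u k.
  have : ((l - 2^-1)%:E < ereal_sup [set (u k)%:E | k in [set k | (n <= k)%N]])%E.
    apply: (@lt_le_trans _ _ l%:E); first by rewrite lte_fin; lra.
    rewrite -ul; apply: ereal_inf_lbound; exists [set k | (n <= k)%N] => //.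
    by exists n.
  by move=> /ereal_sup_gt[_ [k /= nk <-]]; rewrite lte_fin; exists k.
have [n0 n0P] : exists n, forall k, (n <= k)%N -> u k < l + 2^-1.
  have : (limn_esup (fun k => (u k)%:E) < (l + 2^-1)%:E)%E.
    by rewrite ul lte_fin; lra.
  move=> /ereal_inf_lt[_ [V [n _ nV] <-]] ltV; exists n => k nk.
  rewrite -lte_fin; apply: le_lt_trans ltV.
  by apply: ereal_sup_ubound; exists k => //; exact: nV.
have [k0 n0k0 lk0] := often n0.
have near k : (n0 <= k)%N -> l - 2^-1 < u k -> u k = u k0.
  move=> n0k lk; apply: int_num_dist_lt1 => //.
  by have := n0P _ n0k; have := n0P _ n0k0; rewrite ltr_norml; lra.
exists (u k0); split => //.
- by have := n0P _ n0k0; rewrite ltr_norml; lra.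
- move=> n; have [k nk lk] := often (maxn n n0).
  by exists k; [lia | apply: near => //; lia].
- exists n0 => k n0k; have [lk|] := ltP (l - 2^-1) (u k).
    by rewrite (near k).
  by move=> /le_trans; apply; exact: ltW.
Qed.

Implicit Types m n : int.

(* The behaviour of S at -oo: a and b are its lower and upper limits. *)
Definition oscillates_left S (a b : R) :=
  [/\ forall n, exists2 m, m <= n & S m = a,
      forall n, exists2 m, m <= n & S m = b
    & exists n, forall m, m <= n -> a <= S m <= b].

Lemma oscillates_left_uniq S a b a' b' :
  oscillates_left S a b -> oscillates_left S a' b' -> a = a' /\ b = b'.
Proof.
move=> [Sa Sb [n Sn]] [Sa' Sb' [n' Sn']].
have [m1 m1n' Sm1] := Sa n'; have [m2 m2n' Sm2] := Sb n'.
have [m3 m3n Sm3] := Sa' n; have [m4 m4n Sm4] := Sb' n.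
have := Sn' _ m1n'; have := Sn' _ m2n'; have := Sn _ m3n; have := Sn _ m4n.
by rewrite Sm1 Sm2 Sm3 Sm4; split; lra.
Qed.

Lemma oscillates_leftN S a b :
  oscillates_left S a b -> oscillates_left (fun n => - S n) (- b) (- a).
Proof.
move=> [Sa Sb [n Sn]]; split.
- by move=> k; have [m mk Sm] := Sb k; exists m; rewrite // Sm.
- by move=> k; have [m mk Sm] := Sa k; exists m; rewrite // Sm.
- by exists n => m /Sn; lra.
Qed.

Lemma critical_left x : critical R x ->
  let S := encoding R x in exists a b, [/\ oscillates_left S a b, a + 1 <= b
    & forall m n, m <= n -> S m - S n <= b - a].
Proof.
move=> [[_ [K [K0 wK oK]]] _] S; rewrite -/S in wK oK.
have Sint n : S n \is a Num.int by exact: encoding_int.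
pose u k := S (- k%:Z).
move: oK; rewrite /oscillation /limn_einf.
(* Only finite limits survive: any other case makes the oscillation infinite instead of [K]. *)
case Hs : (limn_esup _) => [s| |]; case Hi : (limn_esup _) => [i| |] //=.
rewrite opprK -EFinD => -[siK].
have [b [bint bs ub [nb nbP]]] := limn_esup_int (fun k => Sint (- k%:Z)) Hs.
have uNint k : - u k \is a Num.int by rewrite rpredN; exact: Sint.
(* The lower limit is minus the upper limit of the opposite sequence, so it is [- a] for this
   [a]. *)
have [a [aint ai ua [na naP]]] := limn_esup_int uNint Hi.
have abK : b + a = K%:R.
  apply: int_num_dist_lt1; rewrite ?natr_int ?rpredD// -siK.
  by move: bs ai; rewrite !ltr_norml; lra.
exists (- a), b; split.
- split.
  + move=> n; have [k nk uk] := ua `|n|%N; exists (- k%:Z); first by lia.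
    by rewrite -uk opprK.
  + move=> n; have [k nk uk] := ub `|n|%N; exists (- k%:Z); first by lia.
    by rewrite -uk.
  + exists (- (maxn na nb)%:Z) => m mn.
    have -> : m = - `|m|%N%:Z by lia.
    have := nbP `|m|%N; have := naP `|m|%N; rewrite /u => h1 h2.
    by rewrite h2 ?andbT; [have := h1 ltac:(lia); lra|lia].
- have : (1 : R) <= K%:R by rewrite ler1n.
  by lra.
- move=> m n mn; rewrite opprK abK -lee_fin -wK EFinB.
  apply: le_trans (ereal_sup_ubound _); last by exists n.
  apply: leeB; first exact: runmax_ge.
  by apply: ereal_inf_lbound; exists n => /=.
Qed.

(** * Strict records and the action of [T] *)

Definition record_at S m := forall k : int, k < m -> S k < S m.

(** At a time that is no record, [S] is at most its value at some earlier time; going back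
    repeatedly ends before [n0], where the bound is given. *)
Lemma no_record_le S b n n0 :
    (forall m, m <= n0 -> S m <= b) ->
    (forall m, m <= n -> ~ record_at S m) ->
  forall m, m <= n -> S m <= b.
Proof.
move=> n0b norec.
suff H k m : m <= n0 + k%:Z -> m <= n -> S m <= b.
  by move=> m; apply: (H `|m - n0|%N); lia.
elim: k m => [|k IH] m mk mn; first by apply: n0b; lia.
have /existsNP[j /not_implyP[jm /negP]] := norec m mn.
by rewrite -leNgt => /le_trans; apply; apply: IH; lia.
Qed.

Lemma runmaxE S b n : (forall m, m <= n -> S m <= b) ->
  (exists2 m, m <= n & S m = b) -> runmax S n = b%:E.
Proof.
move=> Sb [m mn Sm]; apply/eqP; rewrite eq_le -{2}Sm runmax_ge// andbT.
by apply: ge_ereal_sup => _ [k /= kn <-]; rewrite lee_fin Sb.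
Qed.

Lemma critical_runmax x : critical R x -> (runmax (encoding R x) 0 < +oo)%E.
Proof.
move=> /critical_left[a [b [_ _ drop]]].
apply: (@le_lt_trans _ _ (b - a)%:E); last exact: ltry.
apply: ge_ereal_sup => _ [m m0 <-]; rewrite lee_fin.
by have := drop _ _ m0; rewrite encoding0 subr0.
Qed.

Lemma encoding_flip x n : encoding R (flip x) n = - encoding R x n.
Proof.
have sN k : step R (flip x) k = - step R x k.
  by rewrite /step /flip; case: (x k) => /=; lra.
by case: n => m /=; [|congr (- _)]; rewrite -sumrN; apply: eq_bigr.
Qed.

(* Until its first record S stays below its upper limit at -oo, b, so T acts
   there as the reflection S |-> 2 b - S (up to a constant), and the record
   level b + 1 is not above the reflected lower limit 2 b - a of TS. *)
Lemma record_pitman x m : critical R x ->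
    record_at (encoding R (pitman R x)) m ->
  exists2 k, k < m & record_at (encoding R x) k.
Proof.
move=> xcr; have M0 := critical_runmax xcr.
rewrite encoding_pitman//; set S := encoding R x.
have [a [b [[Sa Sb [n0 n0P]] ab drop]]] := critical_left xcr.
rewrite -/S in Sa Sb n0P drop.
apply: contraPP => /forall2NP norec.
have Sle j : j < m -> S j <= b.
  move=> jm; apply: (@no_record_le S b (m - 1) n0); last by lia.
    by move=> k /n0P/andP[].
  by move=> k km; have [|//] := norec k; lia.
have Sge : a <= S m.
  by have [j jm Sj] := Sb m; have := drop _ _ jm; rewrite Sj; lra.
have Mb j : j < m -> runmax S j = b%:E.
  move=> jm; apply: runmaxE => [k kj|//]; apply: Sle; lia.
have [k km Sk] := Sa (m - 1).
move=> /(_ k); rewrite /pitman_path (Mb k); last by lia.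
rewrite (runmaxB S m) (Mb (m - 1)); last by lia.
rewrite -EFin_max /= Sk => /(_ ltac:(lia)).
have Sm1 : S (m - 1) <= b by apply: Sle; lia.
have [_ /(_ m)] := encoding_paths0 R x; rewrite -/S => Sstep.
have : S m - S (m - 1) <= 1 by rewrite -Sstep ler_norm.
by rewrite maxEle; case: ifPn => [h|]; [lra|rewrite -ltNge; lra].
Qed.

Lemma no_record_pitman x : critical R x ->
  (forall m, ~ record_at (encoding R x) m) -> pitman R x = flip x.
Proof.
move=> xcr norec; have M0 := critical_runmax xcr.
have [a [b [[Sa Sb [n0 n0P]] ab drop]]] := critical_left xcr.
have Mb n : runmax (encoding R x) n = b%:E.
  apply: runmaxE => // m mn; apply: (@no_record_le _ b m n0) => //.
  by move=> k /n0P/andP[].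
rewrite -(encodingK R (pitman R x)) -(encodingK R (flip x)).
rewrite encoding_pitman//; congr decoding; apply/funext => n.
by rewrite encoding_flip /pitman_path !Mb /=; lra.
Qed.

(** The upper limit [b] is attained arbitrarily early, so every record exceeds [b], which is
    impossible at times so early that [S] stays at most [b]. *)
Lemma record_lower_bound x : critical R x ->
  exists n, forall m, m <= n -> ~ record_at (encoding R x) m.
Proof.
move=> /critical_left[a [b [[_ Sb [n nP]] _ _]]]; exists n => m mn mrec.
have [k km Sk] := Sb (m - 1).
by have := mrec k ltac:(lia); have := nP _ mn; rewrite Sk; lra.
Qed.

(* Criticality of 1 - eta bounds the rises of S by b - a, as that of eta
   bounds its drops. *)
Lemma critical_flip_pitman x : critical R x -> critical R (flip x) ->
  pitman R x = flip x.
Proof.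
move=> xcr fcr; apply: no_record_pitman => // m mrec.
have [a [b [Sab ab drop]]] := critical_left xcr.
have [c [d [Scd cd rise]]] := critical_left fcr.
have [ca db] : c = - b /\ d = - a.
  apply: oscillates_left_uniq Scd _.
  by under [encoding R (flip x)]funext do rewrite encoding_flip;
     exact: oscillates_leftN.
have [Sa Sb _] := Sab.
have [k km Sk] := Sa m; have [j jm Sj] := Sb (m - 1).
have := mrec j ltac:(lia); rewrite Sj.
by have := rise _ _ km; rewrite !encoding_flip Sk; lra.
Qed.

End critical_paths.

(** * Comparing events up to null sets *)

Section almost_everywhere.
Context d d' (T : measurableType d) (T' : measurableType d') (R : realType).

(** Stated for two set functions so as to cover both invariant laws ([nu = mu]) and the return from
    the law of [eta] to [P]. *)
Lemma ae_preimage (mu : set T -> \bar R) (nu : set T' -> \bar R) (f : T -> T')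
    (Q : T' -> Prop) :
    measurable_fun setT f ->
    (forall A, measurable A -> mu (f @^-1` A) = nu A) ->
  {ae nu, forall y, Q y} -> {ae mu, forall x, Q (f x)}.
Proof.
move=> mf muf [N [mN N0 QN]]; exists (f @^-1` N); split.
- by rewrite -[X in measurable X]setTI; exact: mf.
- by rewrite muf.
- by move=> x Qx; exact: QN.
Qed.

Lemma ae_le_measure (mu : {measure set T -> \bar R}) (A B : set T) :
    measurable A -> measurable B -> {ae mu, forall x, A x -> B x} ->
  (mu A <= mu B)%E.
Proof.
move=> mA mB [N [mN N0 ABN]].
rewrite -(measureU0 mB mN N0); apply: le_measure; rewrite ?inE//.
  exact: measurableU.
move=> x Ax; have [Bx|nBx] := pselect (B x); [by left|right].
by apply: ABN => /(_ Ax).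
Qed.

Lemma ae_eq_measure (mu : {measure set T -> \bar R}) (A B : set T) :
    measurable A -> measurable B -> {ae mu, forall x, A x <-> B x} ->
  mu A = mu B.
Proof.
move=> mA mB AB; apply/eqP; rewrite eq_le; apply/andP.
by split; apply: ae_le_measure => //; apply: filterS AB => x [].
Qed.

End almost_everywhere.

(** * Invariant measures and maps that agree almost everywhere *)

Section invariance.
Context d (T : measurableType d) (R : realType) (mu : probability T R).

Definition preserves (f : T -> T) :=
  forall A, measurable A -> mu (f @^-1` A) = mu A.

Lemma preserves_ae_eq (f g : T -> T) :
    measurable_fun setT f -> measurable_fun setT g ->
    {ae mu, forall x, f x = g x} -> preserves f ->
  preserves g.
Proof.
move=> mf mg fg pf A mA; rewrite -(pf A mA); apply: ae_eq_measure.
- by rewrite -[X in measurable X]setTI; exact: mg.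
- by rewrite -[X in measurable X]setTI; exact: mf.
- by apply: filterS fg => x; rewrite /preimage/= => ->.
Qed.

(** Invariance keeps the exceptional null set of the first [k] steps null when it is pulled back
    along [f]. *)
Lemma ae_iter_eq (f g : T -> T) (k : nat) :
    measurable_fun setT f -> preserves f -> {ae mu, forall x, f x = g x} ->
  {ae mu, forall x, iter k f x = iter k g x}.
Proof.
move=> mf pf fg; elim: k => [|k IH]; first exact: aeW.
have := ae_preimage mf pf IH; apply: filterS2 fg => x fgx.
by rewrite !iterSr fgx.
Qed.

Lemma measurable_iter (f : T -> T) (k : nat) :
  measurable_fun setT f -> measurable_fun setT (iter k f).
Proof.
move=> mf; elim: k => [|k IH]; first exact: measurable_id.
exact: (measurableT_comp mf IH).
Qed.

(* B is only invariant almost everywhere; the points whose f-orbit is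
   eventually in B form a strictly invariant set equal to B a.e. *)
Lemma ergodic_ae_invariant (D : set T) (f g : T -> T) (B : set T) :
    measurable_fun setT f -> preserves f -> {ae mu, forall x, f x = g x} ->
    measurable B -> (forall x, B (g x) <-> B x) -> ergodic_on D f mu ->
  mu B = 0%E \/ mu B = 1%E.
Proof.
move=> mf pf fg mB gB erg.
pose A := \bigcup_n \bigcap_k ((iter (n + k) f) @^-1` B).
have mA : measurable A.
  apply: bigcupT_measurable => n; apply: bigcapT_measurable => k.
  by rewrite -[X in measurable X]setTI; exact: measurable_iter.
have AB : mu A = mu B.
  apply: ae_eq_measure => //.
  have := ae_foralln (fun k => ae_iter_eq k mf pf fg).
  apply: filterS => x itx.
  have gkB k : B (iter k g x) <-> B x by elim: k => //= k <-; exact: gB.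
  split; first by move=> [n _ /(_ 0%N I)]; rewrite /preimage/= itx => /gkB.
  by move=> Bx; exists 0%N => // k _; rewrite /preimage/= itx; exact/gkB.
rewrite -AB; apply: erg => //; congr (_ `&` _).
apply/seteqP; split=> x [n _ nB].
  by exists n.+1 => // k _; have := nB k I; rewrite /preimage /mkset addSn iterSr.
exists n => // k _; have := nB k.+1 I.
by rewrite /preimage /mkset addnS iterSr.
Qed.

End invariance.

(** * Invariant laws on critical configurations *)

Section critical_laws.
Variables (R : realType) (mu : probability config R).
Hypothesis mu_critical : {ae mu, forall x, critical R x}.
Implicit Types x : config.

Definition record_before (n : int) : set config :=
  [set x | exists2 m, m <= n & record_at (encoding R x) m].

Lemma measurable_record_before n : measurable (record_before n).
Proof.
(* Countable form: [m = n - i], and the times before [m] are [m - (j + 1)]. *)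
rewrite (_ : record_before n = \bigcup_i \bigcap_j [set x |
    encoding R x (n - i%:Z - j.+1%:Z) < encoding R x (n - i%:Z)]).
  apply: bigcupT_measurable => i; apply: bigcapT_measurable => j.
  rewrite -[X in measurable X]setTI.
  have mlt := measurable_fun_ltr (@measurable_encoding R (n - i%:Z - j.+1%:Z))
    (@measurable_encoding R (n - i%:Z)).
  exact: (mlt measurableT [set true]).
apply/seteqP; split=> x.
  move=> [m mn mrec]; exists `|n - m|%N => // j _ /=.
  by rewrite (_ : n - _ = m) ?mrec//; lia.
move=> [i _ irec]; exists (n - i%:Z); first by lia.
move=> k kni; have /= := irec `|(n - i%:Z - k - 1)%R|%N I.
by rewrite [X in encoding R x X < _](_ : _ = k)//; lia.
Qed.

(* The first record time of T eta exceeds that of eta, so an integer-valued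
   first record time cannot have the same law for both. *)
Lemma pitman_invariant_record n :
  preserves mu (pitman R) -> mu (record_before n) = 0%E.
Proof.
move=> pT; pose F (k : nat) := record_before (n - k%:Z).
have mF k : measurable (F k) by exact: measurable_record_before.
(* [F k] has the probability of its preimage under [T], which lies almost surely in [F k.+1] by
   [record_pitman]. So the probabilities cannot drop although the events decrease. *)
have muF k : (mu (record_before n) <= mu (F k))%E.
  elim: k => [|k IH]; first by rewrite /F subr0.
  apply: le_trans IH _; rewrite -(pT _ (mF k)); apply: ae_le_measure => //.
    rewrite -[X in measurable X]setTI.
    exact: measurable_pitman.
  apply: filterS mu_critical => x xcr [m mn /(record_pitman xcr)[j jm jrec]].
  by exists j => //; lia.
have mcapF : measurable (\bigcap_k F k) by exact: bigcapT_measurable.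
have F0 : mu (\bigcap_k F k) = 0%E.
  apply/negligibleP => //; apply: negligibleS mu_critical => x capF xcr.
  have [m0 m0P] := record_lower_bound xcr.
  have [m mle] := capF `|n - m0|%N I.
  by apply: m0P; lia.
apply/eqP; rewrite eq_le measure_ge0 andbT -F0.
have cvgF : mu (F k) @[k --> \oo] --> mu (\bigcap_k F k).
  apply: nonincreasing_cvg_mu => //.
    by rewrite (le_lt_trans (probability_le1 _ _))// ltry.
  by move=> i j ij; apply/subsetPset => x [m mn mrec]; exists m => //; lia.
rewrite -(cvg_lim _ cvgF)//; apply: lime_ge; last exact: nearW.
by apply/cvg_ex; eexists; exact: cvgF.
Qed.

Lemma pitman_invariant_flip :
  preserves mu (pitman R) -> {ae mu, forall x, pitman R x = flip x}.
Proof.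
move=> pT.
have : {ae mu, forall x, forall n : nat, ~ record_before n%:Z x}.
  apply: ae_foralln => n; exists (record_before n); split.
  - exact: measurable_record_before.
  - exact: pitman_invariant_record.
  - by move=> x /contrapT.
apply: filterS2 mu_critical => x xcr norec.
apply: no_record_pitman => // m mrec.
by apply: (norec `|m|%N); exists m => //; lia.
Qed.

Lemma flip_invariant_critical :
  preserves mu flip -> {ae mu, forall x, critical R (flip x)}.
Proof. by move=> pf; exact: ae_preimage measurable_flip pf mu_critical. Qed.

Lemma flip_invariant_pitman :
  preserves mu flip -> {ae mu, forall x, pitman R x = flip x}.
Proof.
move=> /flip_invariant_critical; apply: filterS2 mu_critical.
exact: critical_flip_pitman.
Qed.

(** * Ergodicity and two-point laws *)

Lemma flipK : involutive flip.
Proof. by move=> x; apply/funext => n; rewrite /flip negbK. Qed.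

(** [T] swaps the two points, both critical, so an invariant event contains both or neither. *)
Lemma two_point_ergodic x :
    [set x; flip x] `<=` critical R -> {ae mu, forall y, [set x; flip x] y} ->
  ergodic_on (critical R) (pitman R) mu.
Proof.
move=> xcr mux A mA TA.
have xc : critical R x by apply: xcr; left.
have fc : critical R (flip x) by apply: xcr; right.
have Afx : A (flip x) <-> A x.
  rewrite -(critical_flip_pitman xc fc).
  have /seteqP[/(_ x) h1 /(_ x) h2] := TA.
  split=> Ax; first by case: h1.
  by case: h2.
have [Ax|nAx] := pselect (A x); [right|left].
  rewrite -(@probability_setT _ _ _ mu); apply: ae_eq_measure => //.
  by apply: filterS mux => y [->|->]; split=> // _; exact/Afx.
rewrite -(measure0 mu); apply: ae_eq_measure => //.
by apply: filterS mux => y [->|->]; split=> // /Afx.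
Qed.

Lemma measurable_coord_neq (n : int) :
  measurable [set x : config | x 0 != x n].
Proof.
have mc := measurable_coord.
rewrite (_ : [set _ | _] =
  ([set x : config | x 0] `\` [set x | x n]) `|`
  ([set x : config | x n] `\` [set x | x 0])).
  by apply: measurableU; apply: measurableD; exact: mc.
apply/seteqP; split=> x /=.
  by case: (x 0); case: (x n) => //= _; [left|right].
by case: (x 0); case: (x n) => //=; case=> -[].
Qed.

Lemma ergodic_two_point :
    preserves mu (pitman R) -> ergodic_on (critical R) (pitman R) mu ->
  exists x, [set x; flip x] `<=` critical R /\
    {ae mu, forall y, [set x; flip x] y}.
Proof.
move=> pT erg; have Tf := pitman_invariant_flip pT.
have mT := measurable_pitman R.
have pf := preserves_ae_eq mT measurable_flip Tf pT.
pose B (n : int) := [set x : config | x 0 != x n].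
(* By triviality of [B n], [c n] is the almost sure value of [x 0 != x n]; hence [x] is [c] or
   [flip c] according to [x 0]. *)
pose c : config := fun n => mu (B n) == 1%E.
have ae_c n : {ae mu, forall x, (x 0 != x n) = c n}.
  have mB : measurable (B n) := measurable_coord_neq n.
  have [B0|B1] : mu (B n) = 0%E \/ mu (B n) = 1%E.
    apply: ergodic_ae_invariant mT pT Tf mB _ erg => x.
    by rewrite /B /flip/=; case: (x 0); case: (x n).
  - have cn : c n = false by rewrite /c B0 eq_sym onee_eq0.
    by exists (B n); split => // x /= /eqP; rewrite cn eqbF_neg negbK.
  - have cn : c n = true by rewrite /c B1 eqxx.
    exists (~` B n); split; first exact: measurableC.
      by rewrite probability_setC// B1 subee.
    by move=> x /= /eqP; rewrite cn eqb_id => /negP.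
have aec : {ae mu, forall y, [set c; flip c] y}.
  have := ae_foralln (fun k => ae_c k%:Z).
  have := ae_foralln (fun k => ae_c (- k%:Z)).
  apply: filterS2 => y yN yP /=.
  have yc n : (y 0 != y n) = c n.
    have [->|->] : n = `|n|%N%:Z \/ n = - `|n|%N%:Z by lia.
      exact: yP.
    exact: yN.
  by case y0: (y 0); [right|left]; apply/funext => n;
     have := yc n; rewrite y0 /flip; case: (y n); case: (c n).
(* Since [c] is built from probabilities, its criticality is read off a typical sample [y], which is
   [c] or [flip c] and is critical together with [flip y]. *)
have aeF : ProperFilter (almost_everywhere mu).
  apply: ae_properfilter_algebraOfSetsType.
  by rewrite [ltRHS](@probability_setT _ _ _ mu) lte01.
have [y [ycc [ycr fcr]]] := @filter_ex _ _ aeF _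
  (filterI aec (filterI mu_critical (flip_invariant_critical pf))).
exists c; split => // z.
by case: ycc ycr fcr => ->; rewrite ?flipK => ycr fcr; case=> ->.
Qed.

End critical_laws.

Theorem theorem1p4 (R : realType) (d : measure_display) (Om : measurableType d)
    (P : probability Om R) (eta : {RV P >-> config})
    (eta_critical : {ae distribution P eta, forall x, critical R x}) :
  [/\ eq_law P (pitman R \o eta) eta <-> eq_law P eta (flip \o eta),
      eq_law P (pitman R \o eta) eta \/ eq_law P eta (flip \o eta) ->
        {ae P, forall w, pitman R (eta w) = flip (eta w)}
    & eq_law P (pitman R \o eta) eta ->
        (ergodic_on (critical R) (pitman R) (distribution P eta) <->
         exists x : config, [set x; flip x] `<=` critical R /\
           {ae distribution P eta, forall y, [set x; flip x] y})].
Proof.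
have mT := measurable_pitman R; have mf := measurable_flip.
have law_pitman : eq_law P (pitman R \o eta) eta <->
    preserves (distribution P eta) (pitman R) by [].
have law_flip : eq_law P eta (flip \o eta) <->
    preserves (distribution P eta) flip.
  by split=> h A mA; have := h A mA.
have Tf : eq_law P (pitman R \o eta) eta \/ eq_law P eta (flip \o eta) ->
    {ae distribution P eta, forall x, pitman R x = flip x}.
  move=> [/law_pitman|/law_flip].
    exact: pitman_invariant_flip.
  exact: flip_invariant_pitman.
split.
- split=> [pT|pf].
    by apply/law_flip; exact: preserves_ae_eq mT mf (Tf (or_introl pT)) pT.
  apply/law_pitman; apply: preserves_ae_eq mf mT _ (law_flip.1 pf).
  by apply: filterS (Tf (or_intror pf)) => x ->.
- by move=> /Tf; apply: ae_preimage => //; exact: measurable_funPT.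
- move=> pT; split; first exact: ergodic_two_point.
  by move=> [x [xcr mux]]; exact: two_point_ergodic mux.
Qed.
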